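(* Let $q$ be an odd prime power, let $n\ge 1$ be an integer coprime to $q$, let $R=\mathbb{F}_q[x]/\langle x^n+1\rangle$, and let $a(x)\in R$. Let $\mathcal{C}=\langle (1,a(x))\rangle\subset R^2$ be the double negacirculant code over $\mathbb{F}_q$ generated as an $R$-module by $(1,a(x))$. Then $\mathcal{C}$ is linear complementary-dual if and only if $\gcd\left(1+a(x)a(-x^{n-1}),\,x^n+1\right)=1$.
   Context: The negashift maps $(x_0,\dots,x_{n-1})\in\mathbb{F}_q^n$ to $(-x_{n-1},x_0,\dots,x_{n-2})$. An $n\times n$ matrix over $\mathbb{F}_q$ is negacirculant if its rows are obtained by successive negashifts from its first row. A double negacirculant (DN) code is a $[2n,n]$ linear code over $\mathbb{F}_q$ with generator matrix $(I,A)$, where $I$ is the identity matrix of order $n$ and $A$ is an $n\times n$ negacirculant matrix. Identify $(c_0,\dots,c_{n-1})\in\mathbb{F}_q^n$ with the class of $c_0+c_1x+\cdots+c_{n-1}x^{n-1}$ in $R=\mathbb{F}_q[x]/\langle x^n+1\rangle$, and hence $\mathbb{F}_q^{2n}$ with $R^2$. The DN code with first row $(a_0,\dots,a_{n-1})$ of $A$ is the $R$-submodule of $R^2$ generated by $(1,a(x))$ with $a(x)=a_0+a_1x+\cdots+a_{n-1}x^{n-1}$. A linear code $\mathcal{C}\subset\mathbb{F}_q^{N}$ is linear complementary-dual (LCD) if $\mathcal{C}\cap\mathcal{C}^{\perp}=\{0\}$, where $\mathcal{C}^\perp$ is the Euclidean dual of $\mathcal{C}$ in $\mathbb{F}_q^N$.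 *)

(* Defs.v *)
From HB Require Import structures.
From mathcomp Require Import all_boot all_order all_algebra.
Set Implicit Arguments.
Unset Strict Implicit.
Unset Printing Implicit Defensive.
Import GRing.Theory.
Local Open Scope ring_scope.

Definition dotprod (F : finFieldType) (N : nat) (u v : 'rV[F]_N) : F :=
  \sum_(i < N) u 0 i * v 0 i.

Definition dual_code (F : finFieldType) (N : nat) (C : {set 'rV[F]_N}) :
    {set 'rV[F]_N} :=
  [set v | [forall u in C, dotprod u v == 0]].

Definition linear_code (F : finFieldType) (N : nat) (C : {set 'rV[F]_N}) : Prop :=
  submod_closed (mem C).

Definition lcd (F : finFieldType) (N : nat) (C : {set 'rV[F]_N}) : Prop :=
  linear_code C /\ C :&: dual_code C = [set 0].

(* For 0 < n the polynomial 'X^n + 1 is monic and nonconstant, so {poly %/ _}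
   is the genuine quotient ring (it is not for n = 0, see mk_monic in qpoly.v).
   Its elements are represented by, and coerce to, polynomials of size <= n. *)
Notation negacyclic_ring F n := {poly %/ ('X^n + 1 : {poly F})}.

(* ^o makes the ring a module over itself, so that the pair is the module R^2. *)
Definition dn_submodule (F : finFieldType) (n : nat) (a : negacyclic_ring F n) :
    {set negacyclic_ring F n * negacyclic_ring F n} :=
  [set r *: ((1, a) : (negacyclic_ring F n)^o * (negacyclic_ring F n)^o)
     | r : negacyclic_ring F n].

Definition coord_word (F : finFieldType) (n : nat)
    (w : negacyclic_ring F n * negacyclic_ring F n) : 'rV[F]_(n + n) :=
  row_mx (poly_rV w.1) (poly_rV w.2).

Definition dn_code (F : finFieldType) (n : nat) (a : negacyclic_ring F n) :
    {set 'rV[F]_(n + n)} :=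
  [set coord_word w | w in dn_submodule a].

(* Main.v *)
(* Let P = X^n + 1, R = F[X]/(P), and let bar be the substitution
   x |-> - x^(n-1) = x^-1, an involutive automorphism of R. The Euclidean inner
   product of the coefficient vectors of f and g is the constant coefficient of
   f * bar g, so with h = 1 + a * bar a = bar h the inner product of (r, r a)
   and (s, s a) equals that of r and s h. Hence (s, s a) lies in the dual of the
   code iff s h = 0, and the code is LCD iff h is not a zero divisor of the
   finite ring R, i.e. iff h is a unit, i.e. iff h is coprime to P. *)
Require Import Defs.
From mathcomp Require Import all_boot all_order all_algebra.
Import GRing.Theory.
Local Open Scope ring_scope.

Section NegacyclicRing.

Set Implicit Arguments.
Unset Strict Implicit.

Variables (F : finFieldType) (n : nat).
Hypothesis n_gt0 : (0 < n)%N.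

Local Notation P := ('X^n + 1 : {poly F}).
Local Notation R := (negacyclic_ring F n).
Local Notation x := (in_qpoly P 'X).
Local Notation y := (in_qpoly P (- 'X^(n.-1))).

Lemma monic_XnD1 : P \is monic.
Proof. by rewrite -[1]/(1%:P) monicXnaddC. Qed.

(** [mk_monic] falls back to ['X] on a constant or non-monic modulus; [n_gt0] excludes that
    default. *)
Lemma mk_monic_XnD1 : mk_monic P = P.
Proof.
by rewrite /mk_monic monic_XnD1 -[1]/(1%:P) size_XnaddC // ltnS n_gt0.
Qed.

Lemma size_mk_monic_XnD1 : size (mk_monic P) = n.+1.
Proof. by rewrite mk_monic_XnD1 -[1]/(1%:P) size_XnaddC. Qed.

Lemma size_negacyclic (f : R) : (size (f : {poly F}) <= n)%N.
Proof. by rewrite -ltnS -size_mk_monic_XnD1 size_mk_monic. Qed.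

Lemma in_qpoly_le (p : {poly F}) :
  (size p <= n)%N -> in_qpoly P p = p :> {poly F}.
Proof. by move=> sp; rewrite in_qpoly_small // size_mk_monic_XnD1. Qed.

Lemma in_qpoly_polyn (f : R) : in_qpoly P f = f.
Proof. exact/val_inj/in_qpoly_le/size_negacyclic. Qed.

Lemma in_qpoly_XnD1 : in_qpoly P P = 0.
Proof. by apply: val_inj; rewrite /= mk_monic_XnD1 Pdiv.RingMonic.rmodpp ?monic_XnD1. Qed.

Lemma negacyclic_Xn : x ^+ n = -1.
Proof.
apply/eqP; rewrite -addr_eq0 -in_qpoly_XnD1 rmorphD rmorphXn.
by rewrite [in X in _ == X]rmorph1.
Qed.

Lemma negacyclic_XV : x * y = 1.
Proof.
rewrite -rmorphM mulrN -exprS prednK // rmorphN rmorphXn.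
by rewrite negacyclic_Xn opprK.
Qed.

(** Since [y] is the inverse of [x], multiplying [x ^+ k * y ^+ k = 1] by [x ^+ (n - k)] turns
    [x ^+ n] into the sign. *)
Lemma negacyclic_VX k : (k <= n)%N -> y ^+ k = - x ^+ (n - k).
Proof.
move=> le_kn; have: x ^+ k * y ^+ k = 1 by rewrite -exprMn negacyclic_XV expr1n.
move/(congr1 ( *%R (x ^+ (n - k)))).
rewrite mulrA -exprD subnK // negacyclic_Xn mulN1r mulr1 => <-.
by rewrite opprK.
Qed.

Lemma negacyclic_Vn : y ^+ n = -1.
Proof. by rewrite negacyclic_VX // subnn expr0. Qed.

Lemma in_qpoly_comp (f p q : {poly F}) :
  in_qpoly P p = in_qpoly P q -> in_qpoly P (f \Po p) = in_qpoly P (f \Po q).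
Proof.
move=> pq; rewrite !comp_polyE !linear_sum; apply: eq_bigr => i _.
by rewrite !linearZ /= !rmorphXn /= pq.
Qed.

Definition bar (f : R) : R := in_qpoly P ((f : {poly F}) \Po - 'X^(n.-1)).

(** Independence of the representative: the substitution sends [P] to [y ^+ n + 1 = 0], so multiples
    of [P] vanish. Multiplicativity of [bar] rests on this, as products in [R] are reduced. *)
Lemma bar_in_qpoly (p : {poly F}) :
  bar (in_qpoly P p) = in_qpoly P (p \Po - 'X^(n.-1)).
Proof.
have P0 : in_qpoly P (P \Po - 'X^(n.-1)) = 0.
  rewrite comp_polyD comp_Xn_poly -polyC1 comp_polyC polyC1 rmorphD rmorphXn /=.
  by rewrite negacyclic_Vn in_qpoly1 addNr.
rewrite /bar /= mk_monic_XnD1 [in RHS](Pdiv.RingMonic.rdivp_eq monic_XnD1 p).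
by rewrite comp_polyD comp_polyM rmorphD rmorphM /= P0 mulr0 add0r.
Qed.

Lemma barD (f g : R) : bar (f + g) = bar f + bar g.
Proof. by rewrite /bar /= comp_polyD rmorphD. Qed.

Lemma barM (f g : R) : bar (f * g) = bar f * bar g.
Proof.
by rewrite -{1}[f]in_qpoly_polyn -{1}[g]in_qpoly_polyn -rmorphM bar_in_qpoly
  comp_polyM rmorphM.
Qed.

Lemma bar1 : bar 1 = 1.
Proof.
by rewrite -(rmorph1 (in_qpoly P)) bar_in_qpoly -[1]/(1%:P) comp_polyC.
Qed.

Lemma barK : involutive bar.
Proof.
move=> f; rewrite {2}/bar bar_in_qpoly -comp_polyA.
rewrite (@in_qpoly_comp _ _ 'X) ?comp_polyXr ?in_qpoly_polyn //.
rewrite linearN /= comp_Xn_poly rmorphN rmorphXn.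
(* Substituting twice turns [x] into [- y ^+ n.-1]; inserting the factor [x * y = 1] gives
   [x * - y ^+ n = x]. *)
rewrite -[LHS]mul1r -negacyclic_XV -mulrA mulrN -exprS prednK //.
by rewrite negacyclic_Vn opprK mulr1.
Qed.

(** The monomials are orthonormal: the product is [x ^+ (i - j)] if [j <= i], and otherwise
    [- x ^+ (n - (j - i))], whose exponent lies strictly between 0 and [n]. *)
Lemma coef0_mul_bar_X (i j : 'I_n) : (x ^+ i * y ^+ j : R)`_0 = (i == j)%:R.
Proof.
have [le_ji | lt_ij] := leqP j i.
  rewrite -(subnK le_ji) exprD -mulrA -exprMn negacyclic_XV expr1n mulr1.
  rewrite -rmorphXn in_qpoly_le; last first.
    by rewrite size_polyXn (leq_ltn_trans _ (ltn_ord i)) // leq_subr.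
  by rewrite coefXn eq_sym subn_eq0 -(inj_eq val_inj) /= eqn_leq le_ji andbT.
have -> : (i == j) = false by rewrite -(inj_eq val_inj) ltn_eqF.
have le_ij := ltnW lt_ij.
have lt_n : (j - i < n)%N by rewrite (leq_ltn_trans _ (ltn_ord j)) // leq_subr.
rewrite -(subnKC le_ij) exprD mulrA -exprMn negacyclic_XV expr1n mul1r.
rewrite (negacyclic_VX (ltnW lt_n)) -rmorphXn.
rewrite -[polyn _]/(- polyn (in_qpoly P _)) coefN in_qpoly_le ?size_polyXn; last first.
  by rewrite ltn_subrL subn_gt0 lt_ij.
by rewrite coefXn eq_sym subn_eq0 leqNgt lt_n oppr0.
Qed.

Lemma poly_sum_ord (f : R) : (f : {poly F}) = \sum_(i < n) f`_i *: 'X^i.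
Proof.
rewrite -poly_def; apply/polyP => i; rewrite coef_poly.
by case: ltnP => // ni; rewrite nth_default // (leq_trans _ ni) ?size_negacyclic.
Qed.

Lemma dotprod_poly_rV (f g : R) :
  dotprod (poly_rV f : 'rV_n) (poly_rV g) = (f * bar g)`_0.
Proof.
(* Expand both factors in monomials; by orthonormality only the diagonal terms reach the constant
   coefficient. *)
have fE : f = \sum_(i < n) f`_i *: x ^+ i.
  rewrite -[LHS]in_qpoly_polyn [in LHS]poly_sum_ord linear_sum.
  by apply: eq_bigr => i _; rewrite linearZ rmorphXn.
have gE : bar g = \sum_(i < n) g`_i *: y ^+ i.
  rewrite /bar [in LHS]poly_sum_ord !linear_sum.
  by apply: eq_bigr => i _; rewrite !linearZ /= comp_Xn_poly rmorphXn.
have coefE (i j : 'I_n) :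
    ((f`_i *: x ^+ i) * (g`_j *: y ^+ j) : R)`_0 = f`_i * g`_j * (i == j)%:R.
  by rewrite -scalerAl -scalerAr scalerA [LHS]coefZ coef0_mul_bar_X.
rewrite gE [in RHS]fE mulr_suml coefn_sum /dotprod; apply: eq_bigr => i _.
rewrite mulr_sumr coefn_sum.
transitivity (\sum_(j < n) f`_i * g`_j * (i == j)%:R); last first.
  by apply: eq_bigr => j _; apply/esym/coefE.
rewrite (bigD1 i) //= big1 => [|j ji]; first by rewrite eqxx mulr1 addr0 !mxE.
by rewrite eq_sym (negPf ji) mulr0.
Qed.

Lemma poly_rV_negacyclic_eq0 (f : R) : (poly_rV f : 'rV_n) = 0 -> f = 0.
Proof.
move=> f0; apply: val_inj => /=; rewrite -(poly_rV_K (size_negacyclic f)) f0.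
exact: linear0.
Qed.

Lemma dotprod_poly_rV_nondegenerate (g : R) :
  (forall f : R, dotprod (poly_rV f : 'rV_n) (poly_rV g) = 0) -> g = 0.
Proof.
move=> g0; apply: poly_rV_negacyclic_eq0; apply/rowP => i; rewrite [RHS]mxE.
(* Pairing with the class of ['X^i] reads off the coefficient of index [i]. *)
have := g0 (in_qpoly P 'X^i); rewrite in_qpoly_le ?size_polyXn //.
rewrite /dotprod (bigD1 i) //= big1 => [|j ji]; rewrite !mxE coefXn.
  by rewrite eqxx mul1r addr0.
by rewrite (inj_eq val_inj) (negPf ji) mul0r.
Qed.

Lemma dn_codeP (a : R) (w : 'rV[F]_(n + n)) :
  reflect (exists s : R, w = coord_word (s, s * a)) (w \in dn_code a).
Proof.
apply: (iffP imsetP) => [[_ /imsetP [s _ ->] ->] | [s ->]].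
  by exists s; congr (coord_word (_, _)); apply: mulr1.
exists (s *: ((1, a) : R^o * R^o)); first exact: imset_f.
by congr (coord_word (_, _)); rewrite /= -[RHS]/(s * 1) mulr1.
Qed.

Lemma linear_dn_code (a : R) : linear_code (dn_code a).
Proof.
split=> [|c u v /dn_codeP [r ->] /dn_codeP [s ->]]; apply/dn_codeP.
  by exists 0; rewrite mul0r /coord_word !linear0 row_mx0.
exists (c *: r + s); rewrite mulrDl -scalerAl /coord_word /=.
by rewrite !linearP /= scale_row_mx add_row_mx.
Qed.

Lemma dotprod_coord_word (a r s : R) :
  dotprod (coord_word (r, r * a)) (coord_word (s, s * a)) =
  dotprod (poly_rV r : 'rV_n) (poly_rV (s * (1 + a * bar a) : R)).
Proof.
transitivity (dotprod (poly_rV r : 'rV_n) (poly_rV s) +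
              dotprod (poly_rV (r * a : R) : 'rV_n) (poly_rV (s * a : R))).
  rewrite /dotprod big_split_ord.
  by congr (_ + _); apply: eq_bigr => i _; rewrite /coord_word ?row_mxEl ?row_mxEr.
rewrite !dotprod_poly_rV -coefD -poly_of_qpolyD !barM barD bar1 barM barK.
(* Applied with [u = r], [v = bar s], [w = a], [z = bar a]. *)
have ringE (A : comNzRingType) (u v w z : A) :
    u * v + u * w * (v * z) = u * (v * (1 + z * w)).
  by rewrite [RHS]mulrA [RHS]mulrDr mulr1 mulrACA [z * w]mulrC.
by congr ((_ : R)`_0); apply: ringE.
Qed.

Lemma dn_code_dualP (a s : R) :
  reflect (s * (1 + a * bar a) = 0)
          (coord_word (s, s * a) \in dual_code (dn_code a)).
Proof.
rewrite inE; apply: (iffP forall_inP) => [dual_s | sh0 _ /dn_codeP [r ->]].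
  apply: dotprod_poly_rV_nondegenerate => r; rewrite -dotprod_coord_word.
  by apply/eqP/dual_s/dn_codeP; exists r.
rewrite dotprod_coord_word sh0 linear0 /dotprod big1 // => i _.
by rewrite [X in _ * X]mxE mulr0.
Qed.

Lemma lcd_dn_codeP (a : R) :
  lcd (dn_code a) <-> (forall s : R, s * (1 + a * bar a) = 0 -> s = 0).
Proof.
have coord0 : coord_word (0 : R, 0 * a) = 0.
  by rewrite mul0r /coord_word !linear0 row_mx0.
split=> [[_ C0] s sh0 | reg_h].
  have : coord_word (s, s * a) \in dn_code a :&: dual_code (dn_code a).
    by rewrite in_setI; apply/andP; split; [apply/dn_codeP; exists s | apply/dn_code_dualP].
  (* The left half of the word is [s] itself, so the zero word forces [s = 0]. *)
  rewrite C0 inE => /eqP; rewrite /coord_word -row_mx0 => /eq_row_mx [s0 _].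
  exact: poly_rV_negacyclic_eq0.
split; first exact: linear_dn_code.
apply/setP => w; rewrite in_setI in_set1; apply/andP/eqP => [[] | ->].
  by move=> /dn_codeP [s ->] /dn_code_dualP /reg_h ->.
rewrite -coord0; split; first by apply/dn_codeP; exists 0.
by apply/dn_code_dualP; rewrite mul0r.
Qed.

Lemma negacyclic_regular_unit (u : R) :
  (forall s : R, s * u = 0 -> s = 0) <-> u \is a GRing.unit.
Proof.
split=> [reg_u | u_unit s su0]; last by rewrite -(mulrK u_unit s) su0 mul0r.
have inj_u : injective ( *%R u : R -> R).
  move=> s t /eqP; rewrite -subr_eq0 -mulrBr mulrC => /eqP/reg_u/eqP.
  by rewrite subr_eq0 => /eqP.
(* [R] is finite, so the injective multiplication by [u] is bijective, and the preimage of 1 inverts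
   [u]. *)
have [v _ uv] := injF_bij inj_u.
by apply/unitrPr; exists (v 1).
Qed.

End NegacyclicRing.

Theorem theorem6p1 (q n : nat) (F : finFieldType) (hF : #|F| = q)
    (hq : odd q) (hn : (0 < n)%N) (hnq : coprime n q)
    (a : negacyclic_ring F n) :
  lcd (dn_code a) <->
  coprimep (1 + (a : {poly F}) * ((a : {poly F}) \Po (- 'X^(n.-1))))
           ('X^n + 1).
Proof.
apply: iff_trans (lcd_dn_codeP hn a) _.
have hE : 1 + a * bar a =
    in_qpoly _ (1 + (a : {poly F}) * ((a : {poly F}) \Po (- 'X^(n.-1)))).
  by rewrite rmorphD /= in_qpoly1 rmorphM /= in_qpoly_polyn.
have -> : coprimep (1 + (a : {poly F}) * ((a : {poly F}) \Po (- 'X^(n.-1))))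
    ('X^n + 1) = (1 + a * bar a \is a GRing.unit).
  (* Units of the quotient are the classes whose representative is coprime to the modulus, and
     reduction modulo ['X^n + 1] preserves coprimality with it. *)
  rewrite hE coprimep_sym -{1}(mk_monic_XnD1 F hn) -coprimep_modr.
  by rewrite Pdiv.IdomainMonic.modpE ?monic_mk_monic.
exact: negacyclic_regular_unit.
Qed.
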